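(* Fix a direct-report ePBS–TEE game $\Gamma^\dagger(\mu)$ with an admissible kernel $\mu$, and let $\beta_1(\mathbf b_1\mid v):=\beta_{1,1}(b_{1,1}\mid v_1)\beta_{2,1}(b_{2,1}\mid v_2)$. The reduced tuple $(\beta_1,\mu,\lambda)$ is implementable by a PBE of $\Gamma^\dagger(\mu)$ in which builders report truthfully and obey every on-path direct bid recommendation if and only if the following conditions hold: (i) for every $i$, the off-path belief pair $\lambda_i=(\lambda_i^H,\lambda_i^A)$ is feasible: at every off-path continuation information set $I$, $\lambda_i^H(\cdot\mid I)\in\Delta(H_i(I,\mu))$ and $\lambda_i^A(\cdot\mid h,I)\in\Delta(\mathcal B_{j,2}(b_{j,1}))$ for each $h=(v_j,b_{j,1},\hat v_j,m_j)\in H_i(I,\mu)$; (ii) there exists an off-path completion $\chi^\lambda=(\chi_1^\lambda,\chi_2^\lambda)$ such that, for every $i$, $\chi_i^\lambda(I)\in\mathrm{BR}^{\mathrm{off}}_{i,2}(I,\lambda_i;\mu)$ at every off-path continuation information set $I$ of builder $i$; (iii) with that same completion $\chi^\lambda$, the stage-1 incentive condition holds: for every $i$, every $v_i,\hat v_i\in\mathcal V$, every $b_{i,1}\in\operatorname{supp}\beta_{i,1}(\cdot\mid v_i)$, every $b'_{i,1}\in\mathcal B$ and every $\delta_i\in\mathcal D_i(b'_{i,1})$, $$U_i(v_i;b_{i,1},v_i,\delta_i^*(\cdot;b_{i,1})\mid\chi_j^\lambda,\mu)\ \ge\ U_i(v_i;b'_{i,1},\hat v_i,\delta_i\mid\c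hi_j^\lambda,\mu).$$
   Context: ePBS–TEE game $\Gamma^\dagger(\mu)$ (two fast builders). Let $\mathcal V\subseteq\mathcal B\subset\mathbb R_+$ be finite sets of values and bids with $0\in\mathcal B$, and $\mathsf F$ a common prior (probability mass function) on $\mathcal V^2$. For $i\in\{1,2\}$, $j$ denotes the other builder; pairs indexed by $(i,j)$ are understood in the corresponding order, e.g. $\mathsf F(v_i,v_j)$. Put $\mathcal B_{i,2}(b)=\{b'\in\mathcal B:b'\ge b\}$. The committed kernel $\mu:\mathcal V^2\times\mathcal B^2\to\Delta\bigl(\{\mathrm{STOP}\}\cup(\{\mathrm{CTN}\}\times\mathcal B^2)\bigr)$ maps reported values and stage-1 bids to a stop decision or a continuation with private recommendations $(m_1,m_2)$; it is admissible if $\mu(\mathrm{CTN},\mathbf m\mid\hat v,\mathbf b_1)>0$ implies $m_i\in\mathcal B_{i,2}(b_{i,1})$ for each $i$. Timing: $(v_1,v_2)\sim\mathsf F$; builder $i$ observes $v_i$, bids $b_{i,1}\in\mathcal B$ by $\beta_{i,1}(\cdot\mid v_i)$ and reports $\hat v_i\in\mathcal V$ by $\alpha_i(\cdot\mid v_i,b_{i,1})$; $\mu$ is applied to $(\hat v,\mathbf b_1)$. After STOP the game ends at stage 1. After $(\mathrm{CTN},\mathbf m)$, builder $i$ observes CTN and $m_i$ and bids $b_{i,2}\in\mathcal B_{i,2}(b_{i,1})$. At the terminal stage $t$ the highest bidder wins (symmetric tie-breaking) and pays its bid; $u_{i,t}(\mathbf b_t;v_i)=k_t(v_i-b_{i,t})\mathbf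 1\{i\text{ wins}\}$ (in expectation over ties), $k_1\ge k_2\ge0$. PBE: an assessment $(\beta_1,\alpha,\beta_2,\lambda)$ whose on-path beliefs satisfy Bayes' rule, whose off-path beliefs are feasible (as in (i)), and whose strategies are all sequentially rational under those beliefs. ''Implementable'' means that the tuple $(\beta_1,\mu,\lambda)$ can be completed to such an assessment. Off-path objects. For an off-path (zero-probability) continuation information set $I=(v_i,b_{i,1},\hat v_i,\mathrm{CTN},m_i)$ let $$H_i(I,\mu)=\{h=(v_j,b_{j,1},\hat v_j,m_j)\in\mathcal V\times\mathcal B\times\mathcal V\times\mathcal B:\ \mu(\mathrm{CTN},(m_i,m_j)\mid(\hat v_i,\hat v_j),(b_{i,1},b_{j,1}))>0\}$$ (only information sets with $H_i(I,\mu)\ne\varnothing$ are considered). Write $\Lambda_i(h,b_{j,2}\mid I)=\lambda_i^H(h\mid I)\lambda_i^A(b_{j,2}\mid h,I)$. The action belief need not be induced by the opponent's strategy. The off-path best-response set is $$\mathrm{BR}^{\mathrm{off}}_{i,2}(I,\lambda_i;\mu)=\arg\max_{b_i'\in\mathcal B_{i,2}(b_{i,1})}\sum_{h\in H_i(I,\mu)}\sum_{b_{j,2}\in\mathcal B_{j,2}(b_{j,1})}\Lambda_i(h,b_{j,2}\mid I)\,u_{i,2}((b_i',b_{j,2});v_i).$$ Reach. $\rho_i(v_i,b_{i,1},m_i)=\sum_{v_j,b_{j,1},m_j}\mathsf F(v_i,v_j)\beta_1(b_{i,1},b_{j,1}\mid v_i,v_j)\mu(\mathrm{CTN},(m_i,m_j)\mid(v_i,v_j),(b_{i,1},b_{j,1}))$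 and $R_i=\mathbf 1\{\rho_i>0\}$. With $I^{\mathrm{tru}}_{i,2}(m_i)=(v_i,b_{i,1},\hat v_i=v_i,\mathrm{CTN},m_i)$, the equilibrium stage-2 bid is $b^*_{i,2}(I^{\mathrm{tru}}_{i,2}(m_i),\chi_i^\lambda)=m_i$ if $R_i(v_i,b_{i,1},m_i)=1$ and $=\chi_i^\lambda(I^{\mathrm{tru}}_{i,2}(m_i))$ if $R_i(v_i,b_{i,1},m_i)=0$. Deviation payoffs. $\mathcal D_i(b)=\{\delta_i:\mathcal B\to\mathcal B:\ \delta_i(m)\in\mathcal B_{i,2}(b)\ \forall m\}$, $\delta_i^*(m;b)=\max\{m,b\}$, and $$\begin{aligned}U_i(v_i;b_{i,1},\hat v_i,\delta_i\mid\chi_j^\lambda,\mu)=\sum_{v_j\in\mathcal V}\sum_{b_{j,1}\in\mathcal B}\mathsf F(v_i,v_j)\beta_{j,1}(b_{j,1}\mid v_j)\Big[&\mu(\mathrm{STOP}\mid(\hat v_i,v_j),(b_{i,1},b_{j,1}))\,u_{i,1}((b_{i,1},b_{j,1});v_i)\\&+\sum_{m_i,m_j\in\mathcal B}\mu(\mathrm{CTN},(m_i,m_j)\mid(\hat v_i,v_j),(b_{i,1},b_{j,1}))\,u_{i,2}\bigl((\delta_i(m_i),b^*_{j,2}(I^{\mathrm{tru}}_{j,2}(m_j),\chi_j^\lambda));v_i\bigr)\Big].\end{aligned}$$ *)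

(* Defs.v *)
From HB Require Import structures.
From mathcomp Require Import all_boot all_order all_algebra.
From mathcomp Require Import finmap reals.
Set Implicit Arguments.
Unset Strict Implicit.
Unset Printing Implicit Defensive.
Import Order.TTheory GRing.Theory Num.Theory.
Local Open Scope ring_scope.

Definition is_pmf (R : realType) (T : finType) (p : T -> R) : Prop :=
  (forall x, 0 <= p x) /\ \sum_x p x = 1.

(* p is an element of Delta(A), viewed as a mass function on the whole of T. *)
Definition is_pmf_on (R : realType) (T : finType) (A : {set T}) (p : T -> R)
  : Prop := is_pmf p /\ (forall x, x \notin A -> p x = 0).

(* Builder 1 is [false] and builder 2 is [true]; [~~ i] is the other builder. *)
Definition player := bool.

(* The pair whose (i, j)-coordinates are x and y, in the order (1, 2). *)
Definition pr (T : Type) (i : player) (x y : T) : T * T :=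
  if i then (y, x) else (x, y).

(* In the kernel, [None] is STOP and [Some m] is (CTN, m). *)
Record game (R : realType) := Game {
  values : {fset R};
  bids : {fset R};
  values_sub_bids : (values `<=` bids)%fset;
  bids_ge0 : forall x, x \in bids -> 0 <= x;
  bids_has0 : 0 \in bids;
  prior : values * values -> R;
  prior_pmf : is_pmf prior;
  kernel : values * values -> bids * bids -> option (bids * bids) -> R;
  kernel_pmf : forall w b, is_pmf (kernel w b);
  k1 : R;
  k2 : R;
  k2_ge0 : 0 <= k2;
  k2_le_k1 : k2 <= k1
}.

(* (v_i, b_{i,1}, reported v_i, m_i). This is both the content of a continuation
   information set of builder i and, for the opponent, a history h in H_j. *)
Definition cinfo (R : realType) (G : game R) : finType :=
  (values G * bids G * values G * bids G)%type.

Definition ival (R : realType) (G : game R) (I : cinfo G) : values G :=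
  I.1.1.1.
Definition ibid (R : realType) (G : game R) (I : cinfo G) : bids G := I.1.1.2.
Definition irep (R : realType) (G : game R) (I : cinfo G) : values G := I.1.2.
Definition imsg (R : realType) (G : game R) (I : cinfo G) : bids G := I.2.

Definition bids_from (R : realType) (G : game R) (b : bids G) : {set bids G} :=
  [set b' | val b <= val b'].

Definition admissible (R : realType) (G : game R) : Prop :=
  forall (w : values G * values G) (b m : bids G * bids G),
    0 < kernel w b (Some m) ->
    m.1 \in bids_from b.1 /\ m.2 \in bids_from b.2.

Definition win_prob (R : realType) (x y : R) : R :=
  if y < x then 1 else if x == y then 2^-1 else 0.

(* Payoff of the builder of value v bidding b against the bid b'. *)
Definition u1 (R : realType) (G : game R) (b b' : bids G) (v : values G) : R :=
  k1 G * (val v - val b) * win_prob (val b) (val b').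
Definition u2 (R : realType) (G : game R) (b b' : bids G) (v : values G) : R :=
  k2 G * (val v - val b) * win_prob (val b) (val b').

Definition ctn_prob (R : realType) (G : game R) (i : player) (I h : cinfo G)
  : R :=
  kernel (pr i (irep I) (irep h)) (pr i (ibid I) (ibid h))
         (Some (pr i (imsg I) (imsg h))).

Definition hists (R : realType) (G : game R) (i : player) (I : cinfo G)
  : {set cinfo G} := [set h | 0 < ctn_prob i I h].

Definition bid_strat (R : realType) (G : game R) := values G -> bids G -> R.
Definition rep_strat (R : realType) (G : game R) :=
  values G -> bids G -> values G -> R.
Definition bid2_strat (R : realType) (G : game R) := cinfo G -> bids G -> R.

Record strategy (R : realType) (G : game R) := Strategy {
  s_bid1 : bid_strat G;
  s_rep : rep_strat G;
  s_bid2 : bid2_strat G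
}.
Arguments s_bid1 {R G} _ _ _.
Arguments s_rep {R G} _ _ _ _.
Arguments s_bid2 {R G} _ _ _.

Definition valid_strategy (R : realType) (G : game R) (s : strategy G) : Prop :=
  [/\ forall v, is_pmf (s_bid1 s v),
      forall v b, is_pmf (s_rep s v b) &
      forall I, is_pmf_on (bids_from (ibid I)) (s_bid2 s I)].

Record belief (R : realType) (G : game R) := Belief {
  bel_hist : cinfo G -> cinfo G -> R;             (* lambda^H(h | I) *)
  bel_act : cinfo G -> cinfo G -> bids G -> R     (* lambda^A(b | h, I) *)
}.

(* Probability that builder i is at I while the opponent's history is h. *)
Definition joint_reach (R : realType) (G : game R) (beta : player -> bid_strat G)
    (alpha : player -> rep_strat G) (i : player) (I h : cinfo G) : R :=
  prior (pr i (ival I) (ival h)) *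
  (beta i (ival I) (ibid I) * beta (~~ i) (ival h) (ibid h)) *
  (alpha i (ival I) (ibid I) (irep I) *
   alpha (~~ i) (ival h) (ibid h) (irep h)) *
  ctn_prob i I h.

Definition reach_prob (R : realType) (G : game R) (beta : player -> bid_strat G)
    (alpha : player -> rep_strat G) (i : player) (I : cinfo G) : R :=
  \sum_(h : cinfo G) joint_reach beta alpha i I h.

Definition off_path (R : realType) (G : game R) (beta : player -> bid_strat G)
    (alpha : player -> rep_strat G) (i : player) (I : cinfo G) : Prop :=
  hists i I != set0 /\ reach_prob beta alpha i I = 0.

Definition truthful_report (R : realType) (G : game R) : rep_strat G :=
  fun v _ w => (w == v)%:R.
Arguments truthful_report {R G} _ _ _.

Definition feasible_at (R : realType) (G : game R) (l : belief G) (i : player)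
    (I : cinfo G) : Prop :=
  is_pmf_on (hists i I) (bel_hist l I) /\
  (forall h, h \in hists i I ->
     is_pmf_on (bids_from (ibid h)) (bel_act l I h)).

Definition belief_payoff (R : realType) (G : game R) (l : belief G) (i : player)
    (I : cinfo G) (b : bids G) : R :=
  \sum_(h in hists i I) \sum_(b' in bids_from (ibid h))
     bel_hist l I h * bel_act l I h b' * u2 b b' (ival I).

Definition BRoff (R : realType) (G : game R) (l : belief G) (i : player)
    (I : cinfo G) : {set bids G} :=
  [set b in bids_from (ibid I) |
    [forall b' in bids_from (ibid I),
       belief_payoff l i I b' <= belief_payoff l i I b]].

(* Payoff, weighted by the prior mass of (v, v_j) instead of its conditional
   probability given v, of builder i of value v who bids b, reports w and then
   bids according to q, against the opponent's strategy sj. *)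
Definition plan_payoff (R : realType) (G : game R) (i : player) (sj : strategy G)
    (v : values G) (b : bids G) (w : values G) (q : bid2_strat G) : R :=
  \sum_(vj : values G) \sum_(bj : bids G) \sum_(wj : values G)
    prior (pr i v vj) * s_bid1 sj vj bj * s_rep sj vj bj wj *
    (kernel (pr i w wj) (pr i b bj) None * u1 b bj v +
     \sum_(mi : bids G) \sum_(mj : bids G)
       kernel (pr i w wj) (pr i b bj) (Some (pr i mi mj)) *
       \sum_(x : bids G) \sum_(y : bids G)
          q (v, b, w, mi) x * s_bid2 sj (vj, bj, wj, mj) y * u2 x y v).

Definition report_payoff (R : realType) (G : game R) (i : player)
    (sj : strategy G) (v : values G) (b : bids G) (a : values G -> R)
    (q : bid2_strat G) : R :=
  \sum_(w : values G) a w * plan_payoff i sj v b w q.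

Definition interim_payoff (R : realType) (G : game R) (i : player)
    (sj : strategy G) (v : values G) (si : strategy G) : R :=
  \sum_(b : bids G)
    s_bid1 si v b * report_payoff i sj v b (s_rep si v b) (s_bid2 si).

(* Optimality, at the information set v, among all complete strategies. *)
Definition rational_bid1 (R : realType) (G : game R) (s : player -> strategy G)
  : Prop :=
  forall i v s', valid_strategy s' ->
    interim_payoff i (s (~~ i)) v s' <= interim_payoff i (s (~~ i)) v (s i).

(* Optimality of the report after every bid b, including zero-probability ones,
   given the builder's own stage-2 strategy. Stage-2 play is not varied jointly
   here: after a zero-probability b it answers to the beliefs held at the
   continuation information sets, which need not agree with the opponent's
   strategy, so it need not be optimal from the viewpoint of (v, b). *)
Definition rational_report (R : realType) (G : game R)
    (s : player -> strategy G) : Prop :=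
  forall i v b a, is_pmf a ->
    report_payoff i (s (~~ i)) v b a (s_bid2 (s i)) <=
    report_payoff i (s (~~ i)) v b (s_rep (s i) v b) (s_bid2 (s i)).

Definition rational_bid2 (R : realType) (G : game R) (s : player -> strategy G)
    (l : player -> belief G) : Prop :=
  forall i I, hists i I != set0 ->
  forall q, is_pmf_on (bids_from (ibid I)) q ->
    \sum_b q b * belief_payoff (l i) i I b <=
    \sum_b s_bid2 (s i) I b * belief_payoff (l i) i I b.

Definition bayes_on_path (R : realType) (G : game R) (s : player -> strategy G)
    (l : player -> belief G) : Prop :=
  let reach := reach_prob (s_bid1 \o s) (s_rep \o s) in
  let joint := joint_reach (s_bid1 \o s) (s_rep \o s) in
  forall i I, 0 < reach i I ->
    (forall h, bel_hist (l i) I h = joint i I h / reach i I) /\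
    (forall h, 0 < joint i I h -> bel_act (l i) I h =1 s_bid2 (s (~~ i)) h).

Definition PBE (R : realType) (G : game R) (s : player -> strategy G)
    (l : player -> belief G) : Prop :=
  [/\ forall i, valid_strategy (s i),
      bayes_on_path s l,
      forall i I, off_path (s_bid1 \o s) (s_rep \o s) i I ->
        feasible_at (l i) i I &
      [/\ rational_bid1 s, rational_report s & rational_bid2 s l]].

Definition rho (R : realType) (G : game R) (beta : player -> bid_strat G)
    (i : player) (v : values G) (b m : bids G) : R :=
  \sum_(vj : values G) \sum_(bj : bids G) \sum_(mj : bids G)
    prior (pr i v vj) * (beta i v b * beta (~~ i) vj bj) *
    kernel (pr i v vj) (pr i b bj) (Some (pr i m mj)).

(* Truthfulness concerns the reports made in equilibrium play, that is, after
   bids in the support of the stage-1 strategy. *)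
Definition truthful (R : realType) (G : game R) (s : player -> strategy G)
  : Prop :=
  forall i v b, 0 < s_bid1 (s i) v b -> s_rep (s i) v b =1 truthful_report v b.

Definition obedient (R : realType) (G : game R) (s : player -> strategy G)
  : Prop :=
  forall i v b m, 0 < rho (s_bid1 \o s) i v b m ->
    forall x, s_bid2 (s i) (v, b, v, m) x = (x == m)%:R.

(* The component lambda of the reduced tuple only matters at off-path
   information sets; on path the beliefs l' of the completed assessment are
   those given by Bayes' rule. *)
Definition implementable (R : realType) (G : game R)
    (beta : player -> bid_strat G) (l : player -> belief G) : Prop :=
  exists (alpha : player -> rep_strat G) (beta2 : player -> bid2_strat G)
         (l' : player -> belief G),
    let s := fun i => Strategy (beta i) (alpha i) (beta2 i) in
    [/\ PBE s l', truthful s, obedient s &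
      forall i I, off_path beta alpha i I ->
        bel_hist (l' i) I =1 bel_hist (l i) I /\
        (forall h, h \in hists i I ->
           bel_act (l' i) I h =1 bel_act (l i) I h)].

Definition completion (R : realType) (G : game R) := cinfo G -> bids G.

Definition bid_star (R : realType) (G : game R) (beta : player -> bid_strat G)
    (chi : player -> completion G) (i : player) (v : values G) (b m : bids G)
  : bids G :=
  if 0 < rho beta i v b m then m else chi i (v, b, v, m).

Definition dev_payoff (R : realType) (G : game R) (beta : player -> bid_strat G)
    (chi : player -> completion G) (i : player) (v : values G) (b : bids G)
    (w : values G) (delta : bids G -> bids G) : R :=
  \sum_(vj : values G) \sum_(bj : bids G)
    prior (pr i v vj) * beta (~~ i) vj bj *
    (kernel (pr i w vj) (pr i b bj) None * u1 b bj v +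
     \sum_(mi : bids G) \sum_(mj : bids G)
       kernel (pr i w vj) (pr i b bj) (Some (pr i mi mj)) *
       u2 (delta mi) (bid_star beta chi (~~ i) vj bj mj) v).

Definition delta_star (R : realType) (G : game R) (b m : bids G) : bids G :=
  if val b <= val m then m else b.

(* Main.v *)
(* A builder's payoff against a truthful opponent depends on its own stage-2
   plan linearly, recommendation by recommendation, so mixed plans do no better
   than the deviations delta_i, and single-recommendation deviations show that
   obeying is optimal under the Bayesian beliefs. Conversely, in an equilibrium
   the opponent may mix off path; the completion is then the highest bid in the
   support of the mixture. This is a best response, and it still deters stage-1
   deviations: a builder gains nothing by bidding above its value, and when it
   bids at most its value its payoff decreases in the opposing bid. *)
Require Import Defs.
From HB Require Import structures.
From mathcomp Require Import all_boot all_order all_algebra.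
From mathcomp Require Import finmap reals.
From mathcomp Require Import ring.
Set Implicit Arguments.
Unset Strict Implicit.
Unset Printing Implicit Defensive.
Import Order.TTheory GRing.Theory Num.Theory.
Local Open Scope ring_scope.

(** * Averages under probability mass functions on a finite type *)

Section FiniteDistributions.
Variables (R : realType) (T : finType).
Implicit Types (p f : T -> R) (a : T).

Lemma sum_pointmass a f : \sum_x (x == a)%:R * f x = f a.
Proof.
rewrite (bigD1 a) //= eqxx mul1r big1 ?addr0 // => x /negbTE->.
by rewrite mul0r.
Qed.

Lemma is_pmf_pointmass a : is_pmf (fun x => (x == a)%:R : R).
Proof.
split=> [x|]; first exact: ler0n.
rewrite -[RHS](sum_pointmass a (fun=> 1)).
by apply: eq_bigr => x _; rewrite mulr1.
Qed.

Lemma is_pmf_on_pointmass (A : {set T}) a :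
  a \in A -> is_pmf_on A (fun x => (x == a)%:R : R).
Proof.
move=> aA; split; first exact: is_pmf_pointmass.
by move=> x; apply: contraNeq; rewrite pnatr_eq0 eqb0 negbK => /eqP->.
Qed.

Lemma pmf_gt0 p x : is_pmf p -> p x != 0 -> 0 < p x.
Proof. by move=> [p0 _] px; rewrite lt0r px p0. Qed.

Lemma ler_pmf_sum p f g : is_pmf p -> (forall x, 0 < p x -> f x <= g x) ->
  \sum_x p x * f x <= \sum_x p x * g x.
Proof.
move=> pp fg; apply: ler_sum => x _.
have [->|/(pmf_gt0 pp) px] := eqVneq (p x) 0; first by rewrite !mul0r.
by rewrite ler_pM2l // fg.
Qed.

Lemma pmf_sum_const p (c : R) : is_pmf p -> \sum_x p x * c = c.
Proof. by move=> [_ p1]; rewrite -mulr_suml p1 mul1r. Qed.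

Lemma pmf_sum_le p f (c : R) : is_pmf p -> (forall x, 0 < p x -> f x <= c) ->
  \sum_x p x * f x <= c.
Proof.
by move=> pp fc; rewrite -[leRHS](pmf_sum_const c pp); apply: ler_pmf_sum.
Qed.

Lemma pmf_sum_ge p f (c : R) : is_pmf p -> (forall x, 0 < p x -> c <= f x) ->
  c <= \sum_x p x * f x.
Proof.
by move=> pp fc; rewrite -[leLHS](pmf_sum_const c pp); apply: ler_pmf_sum.
Qed.

(** The nonnegative terms [p y * (c - f y)], with [c] the mean, sum to zero, so each of them
    vanishes. This is how optimality of a mixture passes to every action in its support. *)
Lemma pmf_mean_attained p f : is_pmf p ->
  (forall x, 0 < p x -> f x <= \sum_y p y * f y) ->
  forall x, 0 < p x -> f x = \sum_y p y * f y.
Proof.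
move=> pp; set c := \sum_y _ => fc x px.
have d0 y : true -> 0 <= p y * (c - f y).
  move=> _; have [->|/(pmf_gt0 pp) py] := eqVneq (p y) 0; first by rewrite mul0r.
  by rewrite mulr_ge0 ?subr_ge0 ?fc // ltW.
have : \sum_y p y * (c - f y) == 0.
  under eq_bigr do rewrite mulrBr.
  by rewrite sumrB pmf_sum_const // subrr.
rewrite (psumr_eq0 _ d0) => /allP/(_ x); rewrite mem_index_enum => /(_ isT) /=.
by rewrite mulf_eq0 gt_eqF //= subr_eq0 => /eqP->.
Qed.

Lemma exists_max (P : pred T) a f :
  P a -> exists2 x, P x & forall y, P y -> f y <= f x.
Proof. by move=> Pa; case: (arg_maxP f Pa) => x Px fx; exists x. Qed.

Lemma pmf_support p : is_pmf p -> exists x, 0 < p x.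
Proof.
move=> pp; apply/existsP; apply: contraT; rewrite negb_exists => /forallP np.
have := pp.2; rewrite big1 => [/esym/eqP|x _]; first by rewrite oner_eq0.
by apply/eqP; apply: contraNT (np x) => /(pmf_gt0 pp).
Qed.

End FiniteDistributions.

Lemma prN (T : Type) (i : player) (x y : T) : pr (~~ i) x y = pr i y x.
Proof. by case: i. Qed.

Section Game.
Variables (R : realType) (G : game R).
Implicit Types (i : player) (v w : values G) (b m x y : bids G) (I h : cinfo G).
Implicit Types (beta : player -> bid_strat G) (o : bid_strat G).

(** * Signs and monotonicity of the auction payoffs *)

Lemma mem_bids_from b x : (x \in bids_from b) = (val b <= val x).
Proof. by rewrite inE. Qed.

Lemma value_ge0 v : 0 <= val v.
Proof. exact/bids_ge0/(fsubsetP (values_sub_bids G))/(valP v). Qed.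

Lemma win_prob_ge0 (s t : R) : 0 <= win_prob s t.
Proof. by rewrite /win_prob; do 2 case: ifP => // _; rewrite invr_ge0. Qed.

Lemma win_prob_anti (s t t' : R) : t <= t' -> win_prob s t' <= win_prob s t.
Proof.
have h1 : (2^-1 : R) <= 1 by rewrite invf_le1 ?ler1n ?ltr0n.
have h0 : 0 <= (2^-1 : R) by rewrite invr_ge0.
rewrite /win_prob => tt'; have [st'|st'|->] := ltgtP s t'.
- by do 2 case: ifP => // _.
- by rewrite (le_lt_trans tt' st').
- by move: tt'; rewrite le_eqVlt eq_sym => /orP[->|->] //; case: ifP.
Qed.

Lemma k1_ge0 : 0 <= k1 G.
Proof. exact: le_trans (k2_ge0 G) (k2_le_k1 G). Qed.

Lemma u1_ge0 b b' v : val b <= val v -> 0 <= u1 b b' v.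
Proof.
by move=> bv; rewrite /u1 !mulr_ge0 ?k1_ge0 ?win_prob_ge0 ?subr_ge0.
Qed.

Lemma u1_le0 b b' v : val v <= val b -> u1 b b' v <= 0.
Proof.
move=> vb; rewrite /u1 mulr_le0_ge0 ?win_prob_ge0 //.
by rewrite mulr_ge0_le0 ?k1_ge0 // subr_le0.
Qed.

Lemma u2_ge0 b b' v : val b <= val v -> 0 <= u2 b b' v.
Proof.
by move=> bv; rewrite /u2 !mulr_ge0 ?k2_ge0 ?win_prob_ge0 ?subr_ge0.
Qed.

Lemma u2_le0 b b' v : val v <= val b -> u2 b b' v <= 0.
Proof.
move=> vb; rewrite /u2 mulr_le0_ge0 ?win_prob_ge0 //.
by rewrite mulr_ge0_le0 ?k2_ge0 // subr_le0.
Qed.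

(** For a bid of at most the value, the margin multiplying [win_prob] is nonnegative, and [win_prob]
    falls as the opposing bid rises. *)
Lemma u2_anti b y y' v :
  val b <= val v -> val y <= val y' -> u2 b y' v <= u2 b y v.
Proof.
move=> bv yy'; rewrite /u2 ler_wpM2l ?win_prob_anti //.
by rewrite mulr_ge0 ?k2_ge0 ?subr_ge0.
Qed.

Lemma prior_ge0 (z : values G * values G) : 0 <= prior z.
Proof. exact: (prior_pmf G).1. Qed.

Lemma kernel_ge0 (w : values G * values G) (b : bids G * bids G) c :
  0 <= kernel w b c.
Proof. exact: (kernel_pmf w b).1. Qed.

(** * Expected payoffs, decomposed by recommendation *)

Definition ctn_gain i o v b w mi (z : values G -> bids G -> bids G -> R) : R :=
  \sum_vj \sum_bj prior (pr i v vj) * o vj bj *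
    \sum_mj kernel (pr i w vj) (pr i b bj) (Some (pr i mi mj)) * z vj bj mj.

(* [z mi vj bj mj] is the expected stage-2 payoff at recommendation [mi] against
   a truthful opponent of value [vj] who bid [bj] and was recommended [mj]. *)
Definition gain i o v b w (z : bids G -> values G -> bids G -> bids G -> R) : R :=
  \sum_vj \sum_bj prior (pr i v vj) * o vj bj *
    (kernel (pr i w vj) (pr i b bj) None * u1 b bj v +
     \sum_mi \sum_mj
       kernel (pr i w vj) (pr i b bj) (Some (pr i mi mj)) * z mi vj bj mj).

(** Setting the stage-2 payoff to zero leaves the STOP part, which no stage-2 plan affects. The
    remainder is one independent term per recommendation, so the response to each can be chosen or
    varied separately. *)
Lemma gainE i o v b w z :
  gain i o v b w z = gain i o v b w (fun _ _ _ _ => 0) +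
    \sum_mi ctn_gain i o v b w mi (z mi).
Proof.
rewrite /ctn_gain exchange_big -big_split; apply: eq_bigr => vj _ /=.
rewrite exchange_big -big_split; apply: eq_bigr => bj _ /=.
rewrite -mulr_sumr -mulrDr -addrA; congr (_ * (_ + _)).
rewrite [X in _ = X + _]big1 ?add0r // => mi _.
by rewrite big1 // => mj _; rewrite mulr0.
Qed.

(** Terms of zero weight drop out, so payoffs need comparing only at events of positive probability.
    This is what makes obedience, which is an on-path property, sufficient later on. *)
Lemma ler_gain i o v b w z z' :
  (forall v b, 0 <= o v b) ->
  (forall mi vj bj mj, 0 < prior (pr i v vj) -> 0 < o vj bj ->
     0 < kernel (pr i w vj) (pr i b bj) (Some (pr i mi mj)) ->
     z mi vj bj mj <= z' mi vj bj mj) ->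
  gain i o v b w z <= gain i o v b w z'.
Proof.
move=> o0 zz; apply: ler_sum => vj _; apply: ler_sum => bj _.
have [->|p0] := eqVneq (prior (pr i v vj)) 0; first by rewrite !mul0r.
have [->|b0] := eqVneq (o vj bj) 0; first by rewrite mulr0 !mul0r.
rewrite ler_wpM2l ?mulr_ge0 ?prior_ge0 // lerD2l.
apply: ler_sum => mi _; apply: ler_sum => mj _.
have [->|k0] := eqVneq (kernel (pr i w vj) (pr i b bj) (Some (pr i mi mj))) 0.
  by rewrite !mul0r.
by rewrite ler_wpM2l ?kernel_ge0 // zz // lt0r ?p0 ?b0 ?k0 ?prior_ge0 ?o0
  ?kernel_ge0.
Qed.

Lemma eq_gain i o v b w z z' :
  (forall v b, 0 <= o v b) ->
  (forall mi vj bj mj, 0 < prior (pr i v vj) -> 0 < o vj bj ->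
     0 < kernel (pr i w vj) (pr i b bj) (Some (pr i mi mj)) ->
     z mi vj bj mj = z' mi vj bj mj) ->
  gain i o v b w z = gain i o v b w z'.
Proof.
move=> o0 zz; apply/le_anti/andP.
by split; apply: ler_gain => // mi vj bj mj *; rewrite zz.
Qed.

Lemma ctn_gain_mean i o v b w mi (q : bids G -> R) z :
  ctn_gain i o v b w mi (fun vj bj mj => \sum_x q x * z x vj bj mj) =
  \sum_x q x * ctn_gain i o v b w mi (z x).
Proof.
under [RHS]eq_bigr do rewrite mulr_sumr.
rewrite [RHS]exchange_big; apply: eq_bigr => vj _ /=.
under [RHS]eq_bigr do rewrite mulr_sumr.
rewrite [RHS]exchange_big; apply: eq_bigr => bj _ /=.
under [RHS]eq_bigr do rewrite mulrCA mulr_sumr.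
rewrite -mulr_sumr [in RHS]exchange_big; congr (_ * _).
apply: eq_bigr => mj _ /=; rewrite mulr_sumr.
by apply: eq_bigr => x _; rewrite mulrCA.
Qed.

(** Opponent bids outside the support have weight zero; after all others the report is the true
    value, which collapses the sum over opposing reports. *)
Lemma plan_payoffE i (s : strategy G) v b w q :
  (forall v b, 0 <= s_bid1 s v b) ->
  (forall v b, 0 < s_bid1 s v b -> s_rep s v b =1 truthful_report v b) ->
  plan_payoff i s v b w q = gain i (s_bid1 s) v b w (fun mi vj bj mj =>
    \sum_x q (v, b, w, mi) x *
      \sum_y s_bid2 s (vj, bj, vj, mj) y * u2 x y v).
Proof.
move=> o0 tr; apply: eq_bigr => vj _; apply: eq_bigr => bj _.
have [->|b0] := eqVneq (s_bid1 s vj bj) 0.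
  by rewrite mulr0 mul0r big1 // => wj _; rewrite !mul0r.
have trj : s_rep s vj bj =1 truthful_report vj bj.
  by apply: tr; rewrite lt0r b0 o0.
under [LHS]eq_bigr do rewrite trj -mulrA.
rewrite -mulr_sumr sum_pointmass; congr (_ * (_ + _)).
apply: eq_bigr => mi _; apply: eq_bigr => mj _; congr (_ * _).
apply: eq_bigr => x _; rewrite mulr_sumr.
by apply: eq_bigr => y _; rewrite mulrA.
Qed.

Lemma dev_payoff_ge0 beta chi i v b w d :
  (forall i v b, 0 <= beta i v b) ->
  val b <= val v -> (forall m, val (d m) <= val v) ->
  0 <= dev_payoff beta chi i v b w d.
Proof.
move=> b0 bv dv; apply: sumr_ge0 => vj _; apply: sumr_ge0 => bj _.
apply: mulr_ge0; first by rewrite mulr_ge0 ?prior_ge0.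
apply: addr_ge0; first by rewrite mulr_ge0 ?kernel_ge0 ?u1_ge0.
apply: sumr_ge0 => mi _; apply: sumr_ge0 => mj _.
by rewrite mulr_ge0 ?kernel_ge0 ?u2_ge0.
Qed.

Lemma dev_payoff_le0 beta chi i v b w d :
  (forall i v b, 0 <= beta i v b) ->
  val v <= val b -> (forall m, val v <= val (d m)) ->
  dev_payoff beta chi i v b w d <= 0.
Proof.
move=> b0 vb vd; apply: sumr_le0 => vj _; apply: sumr_le0 => bj _.
apply: mulr_ge0_le0; first by rewrite mulr_ge0 ?prior_ge0.
rewrite -[leRHS]addr0; apply: lerD.
  by rewrite mulr_ge0_le0 ?kernel_ge0 ?u1_le0.
apply: sumr_le0 => mi _; apply: sumr_le0 => mj _.
by rewrite mulr_ge0_le0 ?kernel_ge0 ?u2_le0.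
Qed.

(** * Reach probabilities under truthful reporting *)

Lemma ctn_prob_ge0 i I h : 0 <= ctn_prob i I h.
Proof. exact: kernel_ge0. Qed.

Lemma joint_reach_ge0 beta alpha i I h :
  (forall i v b, 0 <= beta i v b) -> (forall i v b w, 0 <= alpha i v b w) ->
  0 <= @joint_reach _ G beta alpha i I h.
Proof. by move=> b0 a0; rewrite !mulr_ge0 ?prior_ge0 ?ctn_prob_ge0. Qed.

(** Reports made after zero-probability bids are multiplied by zero. Hence a profile that is
    truthful only on the support reaches the same information sets as one that is truthful
    everywhere. *)
Lemma eq_joint_reach beta alpha alpha' i I h :
  (forall i v b, 0 <= beta i v b) ->
  (forall i v b, 0 < beta i v b -> alpha i v b =1 alpha' i v b) ->
  joint_reach beta alpha i I h = joint_reach beta alpha' i I h.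
Proof.
move=> b0 aa; rewrite /joint_reach.
have [->|bi] := eqVneq (beta i (ival I) (ibid I)) 0.
  by rewrite mul0r mulr0 !mul0r.
have [->|bj] := eqVneq (beta (~~ i) (ival h) (ibid h)) 0.
  by rewrite !mulr0 !mul0r.
by rewrite !aa // lt0r ?bi ?bj b0.
Qed.

Lemma eq_reach_prob beta alpha alpha' i I :
  (forall i v b, 0 <= beta i v b) ->
  (forall i v b, 0 < beta i v b -> alpha i v b =1 alpha' i v b) ->
  reach_prob beta alpha i I = reach_prob beta alpha' i I.
Proof. by move=> b0 aa; apply: eq_bigr => h _; apply: eq_joint_reach. Qed.

Lemma sum_cinfo (F : cinfo G -> R) :
  \sum_h F h = \sum_v \sum_b \sum_w \sum_m F (v, b, w, m).
Proof.
rewrite (pair_bigA _ (fun v b => \sum_w \sum_m F (v, b, w, m))) /=.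
rewrite (pair_bigA _ (fun z w => \sum_m F (z.1, z.2, w, m))) /=.
rewrite (pair_bigA _ (fun z m => F (z.1.1, z.1.2, z.2, m))) /=.
by apply: eq_bigr => [[[[v b] w] m]].
Qed.

(** The truthful report of the opponent is an indicator and removes the sum over [w]. Up to the
    factor [beta i v b], sums over histories then have the form of [ctn_gain]. *)
Lemma sum_joint_reach beta i v b m (F : cinfo G -> R) :
  \sum_h joint_reach beta (fun=> truthful_report) i (v, b, v, m) h * F h =
  beta i v b * \sum_vj \sum_bj prior (pr i v vj) * beta (~~ i) vj bj *
    \sum_mj kernel (pr i v vj) (pr i b bj) (Some (pr i m mj)) *
      F (vj, bj, vj, mj).
Proof.
rewrite sum_cinfo mulr_sumr; apply: eq_bigr => vj _.
rewrite mulr_sumr; apply: eq_bigr => bj _.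
under eq_bigr => wj _.
  rewrite (_ : \sum_mj _ = (wj == vj)%:R * (beta i v b *
    (prior (pr i v vj) * beta (~~ i) vj bj *
    \sum_mj kernel (pr i v wj) (pr i b bj) (Some (pr i m mj)) *
      F (vj, bj, wj, mj)))).
  over.
  rewrite !mulr_sumr; apply: eq_bigr => mj _.
  rewrite /joint_reach /ctn_prob /truthful_report /ival /ibid /irep /imsg /=.
  by rewrite eqxx /=; ring.
by rewrite sum_pointmass.
Qed.

(** This is [sum_joint_reach] with constant weight 1. *)
Lemma rhoE beta i v b m :
  rho beta i v b m =
  reach_prob beta (fun=> truthful_report) i (v, b, v, m).
Proof.
rewrite /reach_prob; under [RHS]eq_bigr do rewrite -[joint_reach _ _ _ _ _]mulr1.
rewrite sum_joint_reach mulr_sumr; apply: eq_bigr => vj _.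
rewrite mulr_sumr; apply: eq_bigr => bj _; rewrite !mulr_sumr.
by apply: eq_bigr => mj _; rewrite mulr1 !mulrA [prior _ * _]mulrC -!mulrA.
Qed.

Lemma reach_truthful beta i I :
  0 < reach_prob beta (fun=> truthful_report) i I -> irep I = ival I.
Proof.
move=> r0; apply/eqP; apply: contraTT r0 => /negbTE ne.
rewrite /reach_prob big1 ?ltxx // => h _.
by rewrite /joint_reach /truthful_report ne mul0r mulr0 mul0r.
Qed.

(** One positive term among nonnegative ones is enough. Applied from both sides, it shows that an
    event of positive probability puts both builders on path. *)
Lemma rho_gt0 beta i vi vj bi bj mi mj :
  (forall i v b, 0 <= beta i v b) ->
  0 < prior (pr i vi vj) -> 0 < beta i vi bi -> 0 < beta (~~ i) vj bj ->
  0 < kernel (pr i vi vj) (pr i bi bj) (Some (pr i mi mj)) ->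
  0 < rho beta i vi bi mi.
Proof.
move=> b0 p0 bi0 bj0 k0; rewrite /rho.
have t0 vj' bj' mj' : 0 <= prior (pr i vi vj') *
    (beta i vi bi * beta (~~ i) vj' bj') *
    kernel (pr i vi vj') (pr i bi bj') (Some (pr i mi mj')).
  by rewrite !mulr_ge0 ?prior_ge0 ?kernel_ge0.
rewrite (bigD1 vj) //= ltr_pwDl //; last first.
  by do 3 (apply: sumr_ge0 => ? _).
rewrite (bigD1 bj) //= ltr_pwDl //; last first.
  by do 2 (apply: sumr_ge0 => ? _).
rewrite (bigD1 mj) //= ltr_pwDl //; last first.
  by apply: sumr_ge0 => ? _.
by rewrite !mulr_gt0.
Qed.

Lemma admissible_pr i z b bj mi mj : admissible G ->
  0 < kernel z (pr i b bj) (Some (pr i mi mj)) ->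
  val b <= val mi /\ val bj <= val mj.
Proof.
by move=> hadm /hadm; rewrite !mem_bids_from; case: i => /= -[].
Qed.

Lemma delta_star_id b m : val b <= val m -> delta_star b m = m.
Proof. by rewrite /delta_star => ->. Qed.

Lemma delta_star_bids_from b m : delta_star b m \in bids_from b.
Proof. by rewrite mem_bids_from /delta_star; case: ifP. Qed.

(** * From an equilibrium to a deterring completion *)

Definition pure_plan b w (d : bids G -> bids G) : strategy G :=
  Strategy (fun _ c => (c == b)%:R) (fun _ _ w' => (w' == w)%:R)
    (fun I x => (x == if ibid I == b then d (imsg I) else ibid I)%:R).

(** The map [d] is known to be feasible only after the bid [b]; after any other stage-1 bid the plan
    repeats that bid, which is always allowed. *)
Lemma valid_pure_plan b w d :
  (forall m, d m \in bids_from b) -> valid_strategy (pure_plan b w d).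
Proof.
move=> db; split=> [v|v c|I] /=; do ?exact: is_pmf_pointmass.
apply: is_pmf_on_pointmass; case: eqP => [->|_] //.
by rewrite mem_bids_from.
Qed.

Lemma interim_pure_plan i s v b w d :
  interim_payoff i s v (pure_plan b w d) =
  plan_payoff i s v b w (s_bid2 (pure_plan b w d)).
Proof. by rewrite /interim_payoff sum_pointmass /report_payoff sum_pointmass. Qed.

(* On path both builders obey, so the completion plays no role here. *)
Lemma plan_payoff_obedient (s : player -> strategy G) chi i v b :
  admissible G -> (forall i v b, 0 <= s_bid1 (s i) v b) ->
  truthful s -> obedient s -> 0 < s_bid1 (s i) v b ->
  plan_payoff i (s (~~ i)) v b v (s_bid2 (s i)) =
  dev_payoff (s_bid1 \o s) chi i v b v (delta_star b).
Proof.
move=> hadm s0 tr ob b0; rewrite plan_payoffE //; last exact: tr.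
apply: eq_gain => // mi vj bj mj p0 bj0 k0.
have ri : 0 < rho (s_bid1 \o s) i v b mi by apply: rho_gt0 k0.
have rj : 0 < rho (s_bid1 \o s) (~~ i) vj bj mj.
  by apply: (@rho_gt0 _ (~~ i) vj v bj b mj mi); rewrite ?negbK ?prN.
have [bmi _] := admissible_pr hadm k0.
rewrite delta_star_id // /bid_star rj.
under eq_bigr do rewrite (ob _ _ _ _ ri).
rewrite sum_pointmass.
under eq_bigr do rewrite (ob _ _ _ _ rj).
by rewrite sum_pointmass.
Qed.

Lemma plan_payoff_pure (s : strategy G) i v b w d :
  (forall v b, 0 <= s_bid1 s v b) ->
  (forall v b, 0 < s_bid1 s v b -> s_rep s v b =1 truthful_report v b) ->
  plan_payoff i s v b w (s_bid2 (pure_plan b w d)) =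
  gain i (s_bid1 s) v b w (fun mi vj bj mj =>
    \sum_y s_bid2 s (vj, bj, vj, mj) y * u2 (d mi) y v).
Proof.
move=> s0 tr; rewrite plan_payoffE //; apply: eq_gain => // mi vj bj mj _ _ _.
by rewrite sum_pointmass /= eqxx.
Qed.

(** Both sides of the deterrence inequality are compared with the equilibrium payoff [E]: every
    supported truthful and obedient bid earns exactly [E], and stage-1 rationality against pure
    plans bounds the deviations by [E]. *)
Lemma PBE_completion (s : player -> strategy G) (l : player -> belief G) :
  admissible G -> PBE s l -> truthful s -> obedient s ->
  exists chi : player -> completion G,
    (forall i I, hists i I != set0 -> chi i I \in BRoff (l i) i I) /\
    (forall i v w b b' (d : bids G -> bids G), 0 < s_bid1 (s i) v b ->
       (forall m, d m \in bids_from b') ->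
       dev_payoff (s_bid1 \o s) chi i v b' w d <=
       dev_payoff (s_bid1 \o s) chi i v b v (delta_star b)).
Proof.
move=> hadm [vs _ _ [rat1 _ rat2]] tr ob.
have s0 i v b : 0 <= s_bid1 (s i) v b by case: (vs i) => /(_ v) [].
have pmf2 i I : is_pmf_on (bids_from (ibid I)) (s_bid2 (s i) I).
  by case: (vs i).
have ex i I : exists y, 0 < s_bid2 (s i) I y /\
    forall z, 0 < s_bid2 (s i) I z -> val z <= val y.
  have [y0 y00] := pmf_support (pmf2 i I).1.
  have [y y1 ymax] := exists_max (fun y => val y)
    (y00 : (fun y => 0 < s_bid2 (s i) I y) y0).
  by exists y.
have /fin_all_exists [chi chiP] i := fin_all_exists (ex i).
exists chi; split=> [i I hI|i v w b b' d b0 db'].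
  have [c0 _] := chiP i I.
  have cin x : 0 < s_bid2 (s i) I x -> x \in bids_from (ibid I).
    by apply: contraTT => /(pmf2 i I).2 ->; rewrite ltxx.
  (* No feasible bid beats the mean payoff of the mixture, so the chosen bid of its support attains
     that mean and is a best response. *)
  have le x : x \in bids_from (ibid I) -> belief_payoff (l i) i I x <=
      \sum_y s_bid2 (s i) I y * belief_payoff (l i) i I y.
    move=> xI; have := rat2 i I hI _ (is_pmf_on_pointmass R xI).
    by rewrite sum_pointmass.
  rewrite inE cin //=; apply/forall_inP => x /le.
  rewrite -(pmf_mean_attained (pmf2 i I).1 _ c0) // => y y0.
  exact/le/cin.
set E := interim_payoff i (s (~~ i)) v (s i).
have leE c w' d' : (forall m, d' m \in bids_from c) ->
    plan_payoff i (s (~~ i)) v c w' (s_bid2 (pure_plan c w' d')) <= E.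
  by move=> d'c; rewrite -interim_pure_plan; apply/rat1/valid_pure_plan.
(* Moving the opponent from its mixture to the top of the support can only hurt a builder that never
   bids above its value in stage 2, so the bound by [E] carries over to [chi]. *)
have leE' c w' d' : (forall m, d' m \in bids_from c) ->
    (forall m, val (d' m) <= val v) ->
    dev_payoff (s_bid1 \o s) chi i v c w' d' <= E.
  move=> d'c d'v; apply: le_trans (leE c w' d' d'c).
  rewrite plan_payoff_pure //; last exact: tr.
  apply: (ler_gain (o := s_bid1 (s (~~ i))) (s0 _)) => mi vj bj mj _ _ _; rewrite /bid_star.
  case: ifP => [rj|_].
    under eq_bigr do rewrite (ob _ _ _ _ rj).
    by rewrite sum_pointmass.
  apply: pmf_sum_ge; first exact: (pmf2 _ _).1.
  by move=> y y0; apply: u2_anti; rewrite ?d'v ?(chiP _ _).2.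
have star c : 0 < s_bid1 (s i) v c ->
    report_payoff i (s (~~ i)) v c (s_rep (s i) v c) (s_bid2 (s i)) =
    dev_payoff (s_bid1 \o s) chi i v c v (delta_star c).
  move=> c0; rewrite /report_payoff.
  under eq_bigr do rewrite (tr _ _ _ c0).
  by rewrite sum_pointmass; apply: plan_payoff_obedient.
(* [E] is the average over supported stage-1 bids of their payoffs, none of which exceeds [E]; hence
   all of them equal [E]. *)
have starE : dev_payoff (s_bid1 \o s) chi i v b v (delta_star b) = E.
  rewrite -star //; apply: pmf_mean_attained b0; first by case: (vs i).
  move=> c c0; rewrite star //.
  apply: le_trans (leE c v _ (delta_star_bids_from c)).
  rewrite plan_payoff_pure //; last exact: tr.
  apply: (ler_gain (o := s_bid1 (s (~~ i))) (s0 _)) => mi vj bj mj p0 bj0 k0; rewrite /bid_star.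
  have rj : 0 < rho (s_bid1 \o s) (~~ i) vj bj mj.
    by apply: (@rho_gt0 _ (~~ i) vj v bj c mj mi); rewrite ?negbK ?prN.
  by under eq_bigr do rewrite (ob _ _ _ _ rj); rewrite rj sum_pointmass.
rewrite starE; have [b'v|vb'] := leP (val b') (val v).
  (* Each stage-2 bid above the value is replaced by [b'], the lowest bid still allowed: a
     nonpositive payoff becomes a nonnegative one. *)
  pose d' m := if val (d m) <= val v then d m else b'.
  apply: le_trans (leE' b' w d' _ _); last 2 first.
  - by move=> m; rewrite /d'; case: ifP => // _; rewrite mem_bids_from.
  - by move=> m; rewrite /d'; case: ifP.
  apply: (ler_gain (o := s_bid1 (s (~~ i))) (s0 _)) => mi vj bj mj _ _ _; rewrite /d'; case: ifP => // dv.
  apply: (@le_trans _ _ 0); first by apply/u2_le0/ltW; rewrite ltNge dv.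
  exact: u2_ge0.
(* After a stage-1 bid above the value every allowed stage-2 bid is above it too, so the deviation
   earns at most 0. Bidding zero throughout earns at least 0 and is itself bounded by [E]. *)
apply: (@le_trans _ _ 0).
  apply: dev_payoff_le0 => // [|m]; first exact: ltW.
  by apply/ltW/(lt_le_trans vb'); rewrite -mem_bids_from.
pose zero : bids G := FSetSub (bids_has0 G).
apply: le_trans (leE' zero v (fun=> zero) _ _).
- by apply: dev_payoff_ge0 => // *; apply: value_ge0.
- by move=> m; rewrite mem_bids_from.
- by move=> m; apply: value_ge0.
Qed.

Lemma eq_belief_payoff (l l' : belief G) i I :
  bel_hist l I =1 bel_hist l' I ->
  (forall h, h \in hists i I -> bel_act l I h =1 bel_act l' I h) ->
  belief_payoff l i I =1 belief_payoff l' i I.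
Proof.
move=> hh aa b; apply: eq_bigr => h hI; apply: eq_bigr => c _.
by rewrite hh aa.
Qed.

Lemma eq_is_pmf_on (T : finType) (A : {set T}) (p p' : T -> R) :
  p =1 p' -> is_pmf_on A p -> is_pmf_on A p'.
Proof.
move=> pp [[p0 p1] pA]; split=> [|x xA]; last by rewrite -pp pA.
by split=> [x|]; [rewrite -pp | rewrite -p1; apply: eq_bigr].
Qed.

(** * From a deterring completion to an equilibrium *)

Section Completion.
Variables (beta : player -> bid_strat G) (l : player -> belief G).
Variable chi : player -> completion G.
Hypothesis hadm : admissible G.
Hypothesis hbeta : forall i v, is_pmf (beta i v).

Let reach := reach_prob beta (fun=> truthful_report).
Let joint := joint_reach beta (fun=> truthful_report).

Hypothesis chiP : forall i I, off_path beta (fun=> truthful_report) i I ->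
  chi i I \in BRoff (l i) i I.
Hypothesis chi_deters : forall i v w b b' (d : bids G -> bids G),
  0 < beta i v b -> (forall m, d m \in bids_from b') ->
  dev_payoff beta chi i v b' w d <= dev_payoff beta chi i v b v (delta_star b).

Let beta_ge0 i v b : 0 <= beta i v b.
Proof. exact: (hbeta i v).1. Qed.

Let joint_ge0 i I h : 0 <= joint i I h.
Proof. by apply: joint_reach_ge0 => // *; apply: ler0n. Qed.

Let reach_ge0 i I : 0 <= reach i I.
Proof. exact: sumr_ge0. Qed.

Let joint_gt0 i I h : 0 < joint i I h -> 0 < beta i (ival I) (ibid I) /\
  0 < ctn_prob i I h.
Proof.
rewrite !lt0r joint_ge0 beta_ge0 ctn_prob_ge0 !andbT !mulf_eq0 !negb_or.
by case/andP => /andP[/andP[_ /andP[->]]].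
Qed.

Let reach_gt0 i I : 0 < reach i I -> exists h, 0 < joint i I h.
Proof.
move=> r0; apply/existsP; apply: contraTT r0; rewrite negb_exists => /forallP h.
rewrite /reach /reach_prob big1 ?ltxx // => x _; apply/eqP.
by apply: contraNT (h x) => j0; rewrite lt0r j0 joint_ge0.
Qed.

(* The last case, where no history is compatible with [I], is a dummy. *)
Definition stage2_bid i I : bids G :=
  if 0 < reach i I then imsg I else if hists i I != set0 then chi i I
  else ibid I.

Lemma off_pathP i I : hists i I != set0 -> ~~ (0 < reach i I) ->
  off_path beta (fun=> truthful_report) i I.
Proof. by rewrite lt0r reach_ge0 andbT negbK => hI /eqP. Qed.

Lemma stage2_bid_from i I : stage2_bid i I \in bids_from (ibid I).
Proof.
rewrite /stage2_bid mem_bids_from; case: ifPn => [r0|r0].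
  have [h /joint_gt0[_ c0]] := reach_gt0 r0.
  exact: (admissible_pr hadm c0).1.
case: ifPn => // hI; rewrite -mem_bids_from.
by have := chiP (off_pathP hI r0); rewrite inE => /andP[].
Qed.

(** The history [h] witnesses that the information set is compatible with some history, which
    excludes the dummy case. *)
Lemma stage2_bidE i v b m h : 0 < ctn_prob i (v, b, v, m) h ->
  stage2_bid i (v, b, v, m) = bid_star beta chi i v b m.
Proof.
move=> c0; rewrite /stage2_bid /bid_star rhoE.
case: ifP => // _; rewrite (_ : _ != _) //.
by apply/set0Pn; exists h; rewrite inE.
Qed.

Definition stage2_strat i : bid2_strat G := fun I x => (x == stage2_bid i I)%:R.

(** Reports must be optimal after zero-probability bids as well. Deterrence makes truth optimal only
    after supported bids, so elsewhere the profile uses a report that maximizes the payoff given its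
    own stage-2 play. *)
Variable best_rep : player -> values G -> bids G -> values G.
Hypothesis best_repP : forall i v b w,
  dev_payoff beta chi i v b w (fun m => stage2_bid i (v, b, w, m)) <=
  dev_payoff beta chi i v b (best_rep i v b)
    (fun m => stage2_bid i (v, b, best_rep i v b, m)).

Definition report_strat i : rep_strat G := fun v b w =>
  (w == if 0 < beta i v b then v else best_rep i v b)%:R.

Definition profile i : strategy G :=
  Strategy (beta i) (report_strat i) (stage2_strat i).

(** On path the action belief is the strategy of the opponent at every history, including those of
    posterior zero; off path [l] is kept verbatim, as implementability of the tuple demands. *)
Definition bayes_belief i : belief G := Belief
  (fun I h => if 0 < reach i I then joint i I h / reach i I
              else bel_hist (l i) I h)
  (fun I h => if 0 < reach i I then stage2_strat (~~ i) h
              else bel_act (l i) I h).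

Let report_truthful i v b : 0 < beta i v b ->
  report_strat i v b =1 truthful_report v b.
Proof. by move=> b0 w; rewrite /report_strat b0. Qed.

Let joint_profile i I h : joint_reach beta report_strat i I h = joint i I h.
Proof. exact: eq_joint_reach. Qed.

Let reach_profile i I : reach_prob beta report_strat i I = reach i I.
Proof. exact: eq_reach_prob. Qed.

Lemma profile_truthful : truthful profile.
Proof. by move=> i v b; apply: report_truthful. Qed.

Lemma profile_obedient : obedient profile.
Proof.
move=> i v b m r0 x /=; rewrite /stage2_strat /stage2_bid.
by rewrite -[reach _ _]rhoE r0.
Qed.

Lemma profile_valid i : valid_strategy (profile i).
Proof.
split=> [v|v b|I] //=; first exact: is_pmf_pointmass.
exact/is_pmf_on_pointmass/stage2_bid_from.
Qed.

Lemma plan_payoff_profile i v b w q :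
  plan_payoff i (profile (~~ i)) v b w q =
  gain i (beta (~~ i)) v b w (fun mi vj bj mj => \sum_x q (v, b, w, mi) x *
    u2 x (bid_star beta chi (~~ i) vj bj mj) v).
Proof.
rewrite plan_payoffE; [|exact: beta_ge0|exact: profile_truthful].
apply: (eq_gain (o := beta (~~ i)) (beta_ge0 _)) => mi vj bj mj _ _ k0; apply: eq_bigr => x _; congr (_ * _).
rewrite sum_pointmass (@stage2_bidE _ _ _ _ (v, b, w, mi)) //.
by rewrite /ctn_prob !prN.
Qed.

Lemma plan_payoff_stage2 i v b w :
  plan_payoff i (profile (~~ i)) v b w (stage2_strat i) =
  dev_payoff beta chi i v b w (fun m => stage2_bid i (v, b, w, m)).
Proof.
rewrite plan_payoff_profile; apply: (eq_gain (o := beta (~~ i)) (beta_ge0 _)) => mi vj bj mj _ _ _.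
by rewrite sum_pointmass.
Qed.

Lemma plan_payoff_profile_on_path i v b : 0 < beta i v b ->
  plan_payoff i (profile (~~ i)) v b v (stage2_strat i) =
  dev_payoff beta chi i v b v (delta_star b).
Proof.
move=> b0; apply: (plan_payoff_obedient (s := profile)) b0 => //.
exact: profile_obedient.
Qed.

(** The payoff is a sum over recommendations of terms linear in the mixture used there, so [d]
    takes, for each recommendation, a bid maximizing its term. *)
Lemma plan_payoff_pure_bound i v b w q :
  (forall I, is_pmf_on (bids_from (ibid I)) (q I)) ->
  exists2 d : bids G -> bids G, forall m, d m \in bids_from b &
    plan_payoff i (profile (~~ i)) v b w q <= dev_payoff beta chi i v b w d.
Proof.
move=> qP; pose c m x := ctn_gain i (beta (~~ i)) v b w m
  (fun vj bj mj => u2 x (bid_star beta chi (~~ i) vj bj mj) v).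
have ex m : exists x, x \in bids_from b /\
    forall y, y \in bids_from b -> c m y <= c m x.
  have bb : b \in bids_from b by rewrite mem_bids_from.
  by have [x] := exists_max (c m) bb; exists x.
have [d dP] := fin_all_exists ex.
exists d => [m|]; first by case: (dP m).
rewrite plan_payoff_profile [dev_payoff _ _ _ _ _ _ _]gainE gainE lerD2l.
apply: ler_sum => m _; rewrite ctn_gain_mean.
have [qpmf q0] := qP (v, b, w, m).
apply: pmf_sum_le qpmf _ => x x0; apply: (dP m).2.
by apply: contraTT x0 => /q0->; rewrite ltxx.
Qed.

Lemma report_payoff_on_path i v b : 0 < beta i v b ->
  report_payoff i (profile (~~ i)) v b (report_strat i v b) (stage2_strat i) =
  dev_payoff beta chi i v b v (delta_star b).
Proof.
move=> b0; rewrite /report_payoff /report_strat b0 sum_pointmass.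
exact: plan_payoff_profile_on_path.
Qed.

(** The payoff of one supported bid [b0] separates the two sides: it bounds every strategy through
    pure plans, and deterrence at each other supported bid shows that none earns less. *)
Lemma profile_rational_bid1 : rational_bid1 profile.
Proof.
move=> i v s' [s1 s2 s3]; have [b0 b00] := pmf_support (hbeta i v).
apply: (@le_trans _ _ (dev_payoff beta chi i v b0 v (delta_star b0))).
  apply: pmf_sum_le => // b _; apply: pmf_sum_le => // w _.
  have [d db] := plan_payoff_pure_bound i v b w s3.
  by move/le_trans; apply; apply: chi_deters.
apply: pmf_sum_ge => [|b bpos]; first exact: hbeta.
rewrite report_payoff_on_path //.
exact/chi_deters/delta_star_bids_from.
Qed.

Lemma profile_rational_report : rational_report profile.
Proof.
move=> i v b a apmf; apply: pmf_sum_le => // w _ /=.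
rewrite plan_payoff_stage2; have [b0|b0] := boolP (0 < beta i v b).
  rewrite report_payoff_on_path //; apply: chi_deters => // m.
  exact: stage2_bid_from.
rewrite /report_payoff /report_strat (negbTE b0) sum_pointmass.
by rewrite plan_payoff_stage2.
Qed.

(** The Bayesian posterior is [joint] divided by a constant, so the interim payoff is a multiple,
    independent of [x], of the contribution of [m] to the stage-1 payoff. *)
Lemma belief_payoff_on_path i v b m x : 0 < reach i (v, b, v, m) ->
  belief_payoff (bayes_belief i) i (v, b, v, m) x =
  beta i v b / reach i (v, b, v, m) * ctn_gain i (beta (~~ i)) v b v m
    (fun vj bj mj => u2 x (bid_star beta chi (~~ i) vj bj mj) v).
Proof.
move=> r0; set I := (v, b, v, m).
transitivity ((reach i I)^-1 *
    \sum_h joint i I h * u2 x (stage2_bid (~~ i) h) v).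
  rewrite /belief_payoff mulr_sumr big_mkcond; apply: eq_bigr => h _.
  rewrite /= r0; case: ifPn => [_|]; last first.
    (* Histories outside [hists] have joint probability zero, so the sum may run over all of
       them. *)
    rewrite inE => c0; suff /eqP-> : joint i I h == 0 by rewrite mul0r mulr0.
    by apply: contraNT c0 => j0; apply: (@joint_gt0 _ _ _ _).2;
      rewrite lt0r j0 joint_ge0.
  rewrite (bigD1 (stage2_bid (~~ i) h)) ?stage2_bid_from //= big1 => [|y].
    by rewrite /stage2_strat eqxx mulr1 addr0 mulrAC mulrC.
  by case/andP=> _ /negbTE ne; rewrite /stage2_strat ne mulr0 mul0r.
rewrite sum_joint_reach mulrA [_^-1 * _]mulrC; congr (_ * _).
apply: eq_bigr => vj _; apply: eq_bigr => bj _; congr (_ * _).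
apply: eq_bigr => mj _.
have [->|k0] := eqVneq (kernel (pr i v vj) (pr i b bj) (Some (pr i m mj))) 0.
  by rewrite !mul0r.
rewrite (@stage2_bidE _ _ _ _ I) // /ctn_prob !prN.
by rewrite lt0r k0 kernel_ge0.
Qed.

(** Deterrence is applied to the plan that departs from [delta_star] only at [m]. The STOP part and
    all other recommendations cancel, leaving the comparison of [x] with [m]. *)
Lemma obedience_optimal i v b m x : 0 < reach i (v, b, v, m) ->
  x \in bids_from b ->
  belief_payoff (bayes_belief i) i (v, b, v, m) x <=
  belief_payoff (bayes_belief i) i (v, b, v, m) m.
Proof.
move=> r0 xb; rewrite !belief_payoff_on_path // ler_wpM2l ?divr_ge0 //.
have [h /joint_gt0[b0 c0]] := reach_gt0 r0.
have bm : val b <= val m := (admissible_pr hadm c0).1.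
pose d m' := if m' == m then x else delta_star b m'.
have db m' : d m' \in bids_from b.
  by rewrite /d; case: ifP => // _; apply: delta_star_bids_from.
have := chi_deters v b0 db.
rewrite [leLHS]gainE [leRHS]gainE lerD2l (bigD1 m) //= [leRHS](bigD1 m) //=.
rewrite /d eqxx delta_star_id //.
rewrite (eq_bigr (fun m' => ctn_gain i (beta (~~ i)) v b v m'
  (fun vj bj mj => u2 (delta_star b m')
    (bid_star beta chi (~~ i) vj bj mj) v))) ?lerD2r // => m' /negbTE ne.
by rewrite ne.
Qed.

(** Reached information sets carry a truthful report, so [obedience_optimal] covers them; at the
    others the belief is [l], to which [chi] is a best response. *)
Lemma profile_rational_bid2 : rational_bid2 profile bayes_belief.
Proof.
move=> i I hI q [qpmf q0]; rewrite sum_pointmass.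
apply: pmf_sum_le qpmf _ => x x0.
have {x0 q0} xI : x \in bids_from (ibid I).
  by apply: contraTT x0 => /q0->; rewrite ltxx.
rewrite /stage2_bid hI; case: ifPn => r0.
  move: I hI r0 xI => [[[v b] w] m] hI r0 xI.
  have /= e := reach_truthful r0; move: r0 xI; rewrite /ival /irep /= in e *.
  by rewrite e; apply: obedience_optimal.
have e : belief_payoff (bayes_belief i) i I =1 belief_payoff (l i) i I.
  by apply: eq_belief_payoff => [h|h _ y] /=; rewrite (negbTE r0).
rewrite !e; have := chiP (off_pathP hI r0).
by rewrite inE => /andP[_ /forall_inP]; apply.
Qed.

Hypothesis feasible : forall i I,
  off_path beta (fun=> truthful_report) i I -> feasible_at (l i) i I.

Lemma off_path_profile i I : off_path beta report_strat i I ->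
  off_path beta (fun=> truthful_report) i I.
Proof. by case=> hI; rewrite reach_profile. Qed.

Lemma bayes_belief_off_path i I : off_path beta report_strat i I ->
  bel_hist (bayes_belief i) I =1 bel_hist (l i) I /\
  (forall h, bel_act (bayes_belief i) I h =1 bel_act (l i) I h).
Proof.
move=> /off_path_profile[_]; rewrite -/(reach i I) => r0.
by split=> [h|h y] /=; rewrite r0 ltxx.
Qed.

Lemma profile_PBE : PBE profile bayes_belief.
Proof.
split; first exact: profile_valid.
- move=> i I /=; rewrite reach_profile => r0; rewrite r0.
  by split=> [h|h _]; rewrite ?joint_profile.
- move=> i I oI; have [eh ea] := bayes_belief_off_path oI.
  have [fh fa] := feasible (off_path_profile oI).
  split; first by apply: eq_is_pmf_on fh => h; rewrite eh.
  by move=> h hI; apply: eq_is_pmf_on (fa h hI) => y; rewrite ea.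
split; [exact: profile_rational_bid1 | exact: profile_rational_report |].
exact: profile_rational_bid2.
Qed.

End Completion.

End Game.

Theorem lemma3 (R : realType) (G : game R) (hadm : admissible G)
    (beta : player -> bid_strat G) (hbeta : forall i v, is_pmf (beta i v))
    (l : player -> belief G) :
  implementable beta l <->
  (forall i I, off_path beta (fun=> truthful_report) i I ->
     feasible_at (l i) i I) /\
  (exists chi : player -> completion G,
     (forall i I, off_path beta (fun=> truthful_report) i I ->
        chi i I \in BRoff (l i) i I) /\
     (forall i (v w : values G) (b b' : bids G) (delta : bids G -> bids G),
        0 < beta i v b ->
        (forall m, delta m \in bids_from b') ->
        dev_payoff beta chi i v b' w delta <=
        dev_payoff beta chi i v b v (delta_star b))).
Proof.
have b0 i v b : 0 <= beta i v b by exact: (hbeta i v).1.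
split=> [[alpha [beta2 [l' [pbe tr ob agree]]]]|[feas [chi [chiP deters]]]].
  (* The conditions measure reach with universal truth-telling, the equilibrium with [alpha];
     truthfulness on the support makes the two agree. *)
  have off i I : off_path beta (fun=> truthful_report) i I ->
      off_path beta alpha i I.
    by case=> hI r0; split; rewrite // (eq_reach_prob _ _ b0 tr).
  split=> [i I /off oI|].
    have [eh ea] := agree i I oI; have [_ _ /(_ i I oI) [fh fa] _] := pbe.
    split; first exact: eq_is_pmf_on eh fh.
    by move=> h hI; apply: eq_is_pmf_on (ea h hI) (fa h hI).
  have [chi [chiP deters]] := PBE_completion hadm pbe tr ob.
  exists chi; split=> // i I /off oI; have [eh ea] := agree i I oI.
  (* The completion is optimal for [l'], which off path gives the same belief payoffs as [l]. *)
  have := chiP i I oI.1; rewrite !inE => /andP[-> /forall_inP br].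
  apply/forall_inP => x xI; have e := eq_belief_payoff eh ea.
  by rewrite -!e br.
have ex i vb : exists w, forall w',
    dev_payoff beta chi i vb.1 vb.2 w'
      (fun m => stage2_bid beta chi i (vb.1, vb.2, w', m)) <=
    dev_payoff beta chi i vb.1 vb.2 w
      (fun m => stage2_bid beta chi i (vb.1, vb.2, w, m)).
  (* The true value [vb.1] serves only to show that there is a report to maximize over. *)
  have [w _ wP] := exists_max (fun w => dev_payoff beta chi i vb.1 vb.2 w
    (fun m => stage2_bid beta chi i (vb.1, vb.2, w, m))) (erefl : predT vb.1).
  by exists w => w'; apply: wP.
have /fin_all_exists [rep repP] i := fin_all_exists (ex i).
pose best i v b := rep i (v, b).
have bestP i v b := repP i (v, b).
exists (report_strat beta best), (stage2_strat beta chi), (bayes_belief beta l chi).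
split.
- exact: profile_PBE.
- exact: profile_truthful.
- exact: profile_obedient.
- by move=> i I /(bayes_belief_off_path l chi hbeta)[? ?].
Qed.
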